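(* Let $\tau$ be a topology on a set $X_n$ with $n$ elements such that $|\tau|\ge 6\cdot 2^{n-4}$. Then the open set polynomial of $\tau$ is unimodal.
   Context: For a topology $\tau$ on a finite set $X_n$ with $n$ elements, $|\tau|$ is the number of open sets and $u_j$ denotes the number of open sets of cardinality $j$ ($0\le j\le n$). The open set polynomial of $\tau$ is $P(x)=\sum_{j=0}^{n}u_jx^j$. A polynomial with coefficient sequence $(a_j)_{j=0}^n$ is unimodal if there are integers $k_0\le k_1$ with $a_0\le a_1\le\dots\le a_{k_0}=a_{k_0+1}=\dots=a_{k_1}\ge a_{k_1+1}\ge\dots\ge a_n$.
   Formalization: The formal theorem assumes n ≥ 5; as stated the claim fails for n = 2, 3, 4 (e.g. for n = 4 the topology ∅, {a}, {b}, {a,b}, {a,b,c}, {a,b,d}, X has 7 ≥ 6 open sets and coefficients 1,2,1,2,1). *)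

(* Defs.v *)
From mathcomp Require Import all_boot all_order all_algebra.
Set Implicit Arguments.
Unset Strict Implicit.
Unset Printing Implicit Defensive.
Import Order.TTheory GRing.Theory Num.Theory.
Local Open Scope ring_scope.

(* [cover F] is the union of the members of [F]. *)
Definition is_topology (T : finType) (tau : {set {set T}}) : Prop :=
  [/\ set0 \in tau,
      [set: T] \in tau,
      forall A B : {set T}, A \in tau -> B \in tau -> A :&: B \in tau
    & forall F : {set {set T}}, F \subset tau -> cover F \in tau].

Definition num_open (T : finType) (tau : {set {set T}}) (j : nat) : nat :=
  #|[set A in tau | #|A| == j]|.

Definition open_set_poly (T : finType) (tau : {set {set T}}) : {poly int} :=
  \sum_(j < #|T|.+1) (num_open tau j)%:Z *: 'X^j.

Definition unimodal_seq (n : nat) (a : nat -> int) : Prop :=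
  exists k0 k1 : nat,
    [/\ (k0 <= k1 <= n)%N,
        forall j : nat, (j < k0)%N -> a j <= a j.+1,
        forall j : nat, (k0 <= j < k1)%N -> a j = a j.+1
      & forall j : nat, (k1 <= j < n)%N -> a j.+1 <= a j].

(* The coefficients up to the degree are compared; for [open_set_poly tau]
   with [tau] a topology, the degree is [#|T|], as [setT] is the only
   open set of that cardinality. *)
Definition unimodal_poly (p : {poly int}) : Prop :=
  unimodal_seq (size p).-1 (fun j => p`_j).

(* Main.v *)
Require Import Defs.
From mathcomp Require Import all_boot all_order all_algebra.
From mathcomp Require Import ring lra zify.

(** A finite topology is determined by the implications that its open sets
obey: x in U implies y in U, for the pairs (x, y) such that every open set
containing x contains y.  An implication that does not follow from the others
excludes further subsets: one implication between distinct points leaves 3/4 of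
them, two leave at most 5/8.  A topology with at least 3/8 of all subsets
therefore obeys few independent implications, except that a point below, or
above, k others still leaves more than 1/2 of the subsets, however large k is.

The proof is a finite search with that exception treated apart.  Starting from
no implication at all, either the list of implications already found presents
the topology, or some set obeys the list without being open and thereby reveals
a new implication ([open_separation]); the branch closes when the list leaves
less than 3/8 of the subsets.  Only the named points matter for the count,
because each further point doubles it ([card_obeys]).  The search [search_large] ends in finitely
many presentations, and in lists where some point has four others above it or
four below it.

In a presentation with m named points, the open set polynomial is (1 + X)^(n - m)
times an explicit polynomial ([sum_obeys]), and multiplication by
1 + X + ... + X^(w - 1) preserves unimodality ([humped_window]): the differences
of consecutive coefficients of the product are differences of coefficients at
distance w.  So a finite check suffices for these cases.

If a has a set S of k >= 4 points above it, at most 1/32 of the subsets are open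
sets containing a, so the open sets avoiding a form at least 11/16 of the subsets
of the other points; they obey at most one implication ([prune_single]).  The
open set polynomial is then, up to factors 1 + X and 1 + X + X^2, a unimodal
monic polynomial plus the next power of X ([sum_star], [sum_star_implication],
[humped_star]).  The case of four points below a follows by taking complements,
which reverses the polynomial ([humped_closed_sets]). *)

Set Implicit Arguments.
Unset Strict Implicit.
Unset Printing Implicit Defensive.
Import Order.TTheory GRing.Theory Num.Theory.

Local Open Scope ring_scope.

(** * Unimodal polynomials *)

Section Humped.
Implicit Types p q : {poly int}.

(** Unimodality without reference to the position of the mode or to the degree.
Nonnegative coefficients make the zero coefficients beyond the degree harmless. *)
Definition humped p :=
  (forall i, 0 <= p`_i) /\
  forall i j k, (i <= j <= k)%N -> Num.min p`_i p`_k <= p`_j.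

Lemma le_or_descent (a : nat -> int) i j : (i <= j)%N ->
  a i <= a j \/ exists2 l, (i <= l < j)%N & a l.+1 < a l.
Proof.
elim: j => [|j IHj]; first by rewrite leqn0 => /eqP->; left.
rewrite leq_eqVlt ltnS => /predU1P[->|le_ij]; first by left.
case: (IHj le_ij) => [le_a|[l /andP[le_il lt_lj] lt_a]]; last first.
  by right; exists l; rewrite // le_il (leqW lt_lj).
have [le_aj|lt_aj] := leP (a j) (a j.+1); first by left; apply: le_trans le_aj.
by right; exists j; rewrite // le_ij ltnS leqnn.
Qed.

Lemma humped_steps p : (forall i, 0 <= p`_i) ->
    (forall i j, (i < j)%N -> p`_i.+1 < p`_i -> p`_j.+1 <= p`_j) ->
  humped p.
Proof.
move=> p_ge0 p_steps; split=> // i j k /andP[le_ij le_jk].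
rewrite ge_min; apply/orP.
have [|[l /andP[_ lt_lj] lt_l]] := le_or_descent (fun l => p`_l) le_ij; first by left.
right; elim: k le_jk => [|k IHk]; first by rewrite leqn0 => /eqP->.
rewrite leq_eqVlt ltnS => /predU1P[->//|le_jk].
by apply: le_trans (IHk le_jk); apply: p_steps lt_l; apply: leq_trans le_jk.
Qed.

Lemma unimodal_humped p : humped p -> unimodal_poly p.
Proof.
case=> p_ge0 p_hump; set n := (size p).-1.
pose k := [arg max_(i > (ord0 : 'I_n.+1)) p`_i]%O.
have p_max j : (j <= n)%N -> p`_j <= p`_k.
  rewrite -ltnS => lt_jn; rewrite /k; case: arg_maxP => // i _ /(_ (Ordinal lt_jn)).
  exact.
have le_kn : (k <= n)%N by rewrite -ltnS.
exists k, k; split=> [|j lt_jk|j|j /andP[le_kj lt_jn]].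
- by rewrite leqnn.
- have := p_hump j j.+1 k; rewrite leqnSn lt_jk => /(_ isT).
  by rewrite ge_min => /orP[//|/(le_trans _)->//]; apply: p_max; lia.
- by move=> /andP[le_kj /(leq_ltn_trans le_kj)]; rewrite ltnn.
have := p_hump k j j.+1; rewrite leqnSn le_kj => /(_ isT).
rewrite ge_min => /orP[le_k|//]; apply: le_trans le_k; exact: p_max.
Qed.

(** With (X - 1) (1 + ... + X^(w-1)) = X^w - 1, the product descends at [i]
exactly when [p] is smaller at [i.+1] than at [i.+1 - w].  A descent at [i] and
an ascent at a later [j] compare four coefficients of [p] in a way that would
leave a valley. *)
Lemma humped_window w p : humped p -> humped ((\sum_(i < w) 'X^i) * p).
Proof.
case=> p_ge0 p_hump; set q := _ * p.
have coefq j : q`_j = \sum_(i < w) (if (j < i)%N then 0 else p`_(j - i)).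
  by rewrite /q mulr_suml coef_sum; apply: eq_bigr => i _; rewrite coefXnM.
have q_step j : q`_j - q`_j.+1 = (if (j.+1 < w)%N then 0 else p`_(j.+1 - w)) - p`_j.+1.
  have /(congr1 (fun r : {poly int} => r`_j.+1)) : ('X - 1) * q = ('X^w - 1) * p.
    by rewrite subrX1 mulrA.
  by rewrite !mulrBl !mul1r !coefB coefXM coefXnM.
apply: humped_steps => [j|i j lt_ij lt_q].
  by rewrite coefq sumr_ge0 // => i _; case: ifP.
have := q_step i; have := q_step j.
case: ltnP => [lt_jw|le_wj]; case: ltnP => [lt_iw|le_wi].
- have := p_ge0 i.+1; lra.
- lia.
- have := p_ge0 i.+1; lra.
(* The outer positions are [i.+1 - w] and [j.+1]; the positions [i.+1] and
   [j.+1 - w] lie between them, in an order that depends on [w]. *)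
have := p_hump (i.+1 - w)%N i.+1 j.+1; have := p_hump (i.+1 - w)%N (j.+1 - w)%N j.+1.
have -> : (i.+1 - w <= j.+1 - w <= j.+1)%N by lia.
have -> : (i.+1 - w <= i.+1 <= j.+1)%N by lia.
rewrite !ge_min => /(_ isT)/orP h1 /(_ isT)/orP h2.
by case: h1; case: h2; lra.
Qed.

Lemma humped_1 : humped 1.
Proof.
apply: humped_steps => [i|i j lt_ij]; rewrite !coef1; first by case: eqP.
by case: eqP => // _; case: eqP => // j0; rewrite j0 in lt_ij.
Qed.

Lemma humped_trinomial p : humped p -> humped ((1 + 'X + 'X^2) * p).
Proof.
by move/(humped_window 3); rewrite !big_ord_recr big_ord0 /= add0r expr0 expr1.
Qed.

Lemma humped_binomialX r p : humped p -> humped ((1 + 'X) ^+ r * p).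
Proof.
move=> hp; elim: r => [|r IHr]; first by rewrite expr0 mul1r.
rewrite exprS -mulrA; move/(humped_window 2): IHr.
by rewrite !big_ord_recr big_ord0 /= add0r expr0 expr1.
Qed.

(** The new top coefficient 1 equals the leading coefficient just before it, so
it prolongs the descent. *)
Lemma humped_addXsize p : p \is monic -> humped p -> humped (p + 'X^(size p)).
Proof.
move=> mon_p [p_ge0 p_hump].
have p_gt0 : (0 < size p)%N by rewrite size_poly_gt0 monic_neq0.
apply: humped_steps => [i|i j lt_ij]; rewrite !coefD !coefXn.
  by rewrite addr_ge0 //; case: eqP.
have [lt_js|] := ltnP j.+1 (size p).
  rewrite !ltn_eqF ?addr0; try lia.
  move=> lt_p; have := p_hump i i.+1 j.+1; have := p_hump i j j.+1.
  have -> : (i <= i.+1 <= j.+1)%N by lia.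
  have -> : (i <= j <= j.+1)%N by lia.
  rewrite !ge_min => /(_ isT)/orP h1 /(_ isT)/orP h2.
  by case: h1; case: h2; lra.
rewrite leq_eqVlt => /predU1P[sz_p|lt_sj] _.
  rewrite sz_p eqxx nth_default ?sz_p // (_ : p`_j = 1) ?ltn_eqF //.
  by rewrite -(monicP mon_p) lead_coefE sz_p.
by rewrite [p`_j.+1]nth_default 1?ltnW // gtn_eqF //= addr0 addr_ge0 //; case: eqP.
Qed.

Lemma humped_rev n p q : humped p ->
  (forall j, q`_j = if (j <= n)%N then p`_(n - j) else 0) -> humped q.
Proof.
move=> [p_ge0 p_hump] defq.
have q_ge0 j : 0 <= q`_j by rewrite defq; case: ifP.
split=> // i j k /andP[le_ij le_jk].
have [le_kn|lt_nk] := leqP k n; last first.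
  by rewrite ge_min [q`_k]defq leqNgt lt_nk q_ge0 orbT.
rewrite !defq le_kn !(leq_trans _ le_kn) //; last exact: leq_trans le_jk.
by rewrite minC; apply: p_hump; lia.
Qed.

End Humped.

(** * Generating functions of families of subsets *)

Section SubsetSums.
Variables (T : finType) (R : comNzRingType) (x : R).
Implicit Types (A B D U : {set T}).

Lemma sum_subsets_split (D : {set T}) c (F : {set T} -> R) : c \in D ->
  \sum_(U : {set T} | U \subset D) F U =
  \sum_(U : {set T} | U \subset D :\ c) F U +
  \sum_(U : {set T} | U \subset D :\ c) F (c |: U).
Proof.
move=> cD; rewrite (bigID (fun U : {set T} => c \in U)) [LHS]addrC /=; congr (_ + _).
  by apply: eq_bigl => U; rewrite subsetD1.
rewrite (reindex_onto (fun U => c |: U) (fun U => U :\ c)) /=; last first.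
  by move=> U /andP[_ cU]; rewrite setD1K.
apply: eq_bigl => U; rewrite setU11 andbT subUset sub1set cD /= subsetD1.
congr (_ && _); apply/eqP/idP => [<-|cU]; last by rewrite setU1K.
by rewrite !inE eqxx.
Qed.

Lemma sum_subsets D :
  \sum_(U : {set T} | U \subset D) x ^+ #|U| = (1 + x) ^+ #|D|.
Proof.
have [n] := ubnP #|D|; elim: n D => // n IHn D; rewrite ltnS => leDn.
have [->|[c cD]] := set_0Vmem D.
  rewrite cards0 expr0 (big_pred1 set0) ?cards0 ?expr0 // => U.
  by rewrite /= subset0.
have cardD := cardsD1 c D; rewrite cD in cardD.
rewrite (sum_subsets_split _ cD) IHn; last by rewrite -ltnS; lia.
rewrite (eq_bigr (fun U => x * x ^+ #|U|)); last first.
  by move=> U; rewrite subsetD1 => /andP[_ cU]; rewrite cardsU1 cU exprS.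
by rewrite -mulr_sumr IHn ?cardD ?exprS; [ring | lia].
Qed.

Lemma sum_interval A B : A \subset B ->
  \sum_(U : {set T} | (A \subset U) && (U \subset B)) x ^+ #|U| =
  x ^+ #|A| * (1 + x) ^+ #|B :\: A|.
Proof.
move=> sAB; rewrite -sum_subsets mulr_sumr.
rewrite (reindex_onto (fun V => A :|: V) (fun U => U :\: A)) /=; last first.
  by move=> U /andP[sAU _]; rewrite setDE setUIr setUCr setIT; apply/setUidPr.
apply: eq_big => [V|V].
  rewrite subsetUl subUset sAB /= subsetD setDUl setDv set0U; congr (_ && _).
  exact/eqP/setDidPl.
move=> /andP[_ /eqP defV]; rewrite -exprD -cardsUI (_ : A :&: V = set0) ?cards0 ?addn0 //.
by rewrite -defV setIDA setIC setDIl setDv setI0.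
Qed.
End SubsetSums.

Lemma card_interval (T : finType) (A B : {set T}) : A \subset B ->
  #|[set U : {set T} | (A \subset U) && (U \subset B)]| = (2 ^ #|B :\: A|)%N.
Proof.
move=> sAB; apply/eqP; rewrite -eqz_nat -!natz -sum1_card natr_sum.
rewrite (eq_bigl (fun U : {set T} => (A \subset U) && (U \subset B))) /=;
  last by move=> U; rewrite inE.
rewrite (eq_bigr (fun U : {set T} => 1%:Z ^+ #|U|)) => [|U _]; last by rewrite expr1n.
by rewrite sum_interval // expr1n mul1r natrX.
Qed.

(** * Families cut out by implications between named points *)

Fixpoint bitvecs (m : nat) : seq bitseq :=
  if m is m'.+1 then map (cons false) (bitvecs m') ++ map (cons true) (bitvecs m')
  else [:: [::]].

(** The pair (i, j) says that a set containing the point of name [i] contains the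
point of name [j]; names are positions in a duplicate-free sequence of points. *)
Definition implications := seq (nat * nat).

Definition obeys (E : implications) (v : bitseq) :=
  all (fun p => nth false v p.1 ==> nth false v p.2) E.

Definition models m (E : implications) := [seq v <- bitvecs m | obeys E v].

Definition scoped m (E : implications) := all (fun p => (p.1 < m) && (p.2 < m))%N E.

Definition profile (T : finType) (s : seq T) (U : {set T}) : bitseq :=
  [seq x \in U | x <- s].

Section Profiles.
Variable T : finType.
Implicit Types (s t : seq T) (U : {set T}) (E : implications).

Lemma nth_profile x0 s U i : (i < size s)%N ->
  nth false (profile s U) i = (nth x0 s i \in U).
Proof. exact: nth_map. Qed.

Lemma nth_profile_index s U x : x \in s ->
  nth false (profile s U) (index x s) = (x \in U).
Proof. by move=> xs; rewrite (nth_map x) ?index_mem // nth_index. Qed.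

Lemma profile_bitvecs s U : profile s U \in bitvecs (size s).
Proof.
elim: s => [|x s IHs] //=; rewrite mem_cat.
by case: (x \in U); rewrite map_f ?orbT.
Qed.

Lemma scoped_cat s t E U : scoped (size s) E ->
  obeys E (profile (s ++ t) U) = obeys E (profile s U).
Proof.
move=> /allP ovE; apply: eq_in_all => p /ovE /andP[lt1 lt2].
by rewrite /profile map_cat !nth_cat size_map lt1 lt2.
Qed.

Lemma scoped_widen m m' E : (m <= m')%N -> scoped m E -> scoped m' E.
Proof.
move=> le_m; apply: sub_all => p /andP[lt1 lt2].
by rewrite !(leq_trans _ le_m).
Qed.

(** A set is its trace on the named points together with an arbitrary subset of
the others, and the latter contribute the power of [1 + x]. *)
Lemma sum_profiles (R : comNzRingType) (x : R) s (F : bitseq -> R) : uniq s ->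
  \sum_(U : {set T}) F (profile s U) * x ^+ #|U| =
  (1 + x) ^+ (#|T| - size s) * \sum_(v <- bitvecs (size s)) F v * x ^+ count id v.
Proof.
move=> uniq_s.
(* Relative to an arbitrary [D], so that naming a point amounts to removing
   it from [D]. *)
suff gen (D : {set T}) : {subset s <= D} ->
    \sum_(U : {set T} | U \subset D) F (profile s U) * x ^+ #|U| =
    (1 + x) ^+ (#|D| - size s) *
      \sum_(v <- bitvecs (size s)) F v * x ^+ count id v.
  rewrite -cardsT -gen => [|z]; last by rewrite inE.
  by apply: eq_bigl => U; rewrite subsetT.
elim: s uniq_s D F => [|c s IHs] /= => [_|/andP[cs uniq_s]] D F sD.
  rewrite subn0 big_seq1 -mulr_sumr sum_subsets /= expr0 mulr1.
  by rewrite mulrC.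
have cD : c \in D by apply: sD; rewrite mem_head.
have sDc : {subset s <= D :\ c}.
  move=> z zs; rewrite !inE (sD z) ?inE ?zs ?orbT // andbT.
  by apply: contraNneq cs => <-.
have cardD : (#|D| - (size s).+1)%N = (#|D :\ c| - size s)%N.
  by rewrite (cardsD1 c D) cD.
rewrite (sum_subsets_split _ cD) big_cat !big_map cardD mulrDr /=.
rewrite -(IHs uniq_s _ (fun v => F (false :: v)) sDc); congr (_ + _).
  by apply: eq_bigr => U; rewrite subsetD1 => /andP[_ /negbTE->].
under [in RHS]eq_bigr do rewrite exprS mulrCA.
rewrite -mulr_sumr mulrCA -(IHs uniq_s _ (fun v => F (true :: v)) sDc) mulr_sumr.
apply: eq_bigr => U; rewrite subsetD1 => /andP[_ cU].
rewrite setU11 cardsU1 cU exprS mulrCA; congr (_ * (F (_ :: _) * _)).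
apply/eq_in_map => z zs; rewrite !inE; case: eqP => // eq_z.
by rewrite -eq_z zs in cs.
Qed.

Lemma sum_obeys (R : comNzRingType) (x : R) s E : uniq s ->
  \sum_(U : {set T} | obeys E (profile s U)) x ^+ #|U| =
  (1 + x) ^+ (#|T| - size s) * \sum_(v <- models (size s) E) x ^+ count id v.
Proof.
move=> uniq_s; rewrite big_filter big_mkcond [in RHS]big_mkcond.
rewrite (eq_bigr (fun U => (obeys E (profile s U))%:R * x ^+ #|U|)); last first.
  by move=> U _; case: ifP; rewrite ?mul1r ?mul0r.
rewrite (sum_profiles _ (fun v => (obeys E v)%:R)) //; congr (_ * _).
by apply: eq_bigr => v _; case: ifP; rewrite ?mul1r ?mul0r.
Qed.

Lemma card_obeys s E : uniq s ->
  #|[set U | obeys E (profile s U)]| =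
    (2 ^ (#|T| - size s) * size (models (size s) E))%N.
Proof.
move=> uniq_s; apply/eqP; rewrite -eqz_nat -!natz natrM -sum1_card natr_sum.
rewrite (eq_bigr (fun U => 1%:Z ^+ #|U|)) => [|U _]; last by rewrite expr1n.
rewrite (eq_bigl (fun U => obeys E (profile s U))) /= => [|U]; last by rewrite inE.
rewrite sum_obeys // natrX; apply/eqP; congr (_ * _).
rewrite (eq_bigr (fun=> 1)) => [|v _]; last by rewrite expr1n.
by rewrite big_const_seq count_predT iter_addr addr0.
Qed.

Lemma size_uniq_card s : uniq s -> (size s <= #|T|)%N.
Proof. by move/card_uniqP <-; apply: max_card. Qed.

End Profiles.

Local Close Scope ring_scope.

Definition size_counts m (vs : seq bitseq) : seq nat :=
  [seq count (fun v => count id v == j) vs | j <- iota 0 m.+1].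

(** A decidable form of the criterion of [humped_steps]. *)
Definition no_valley (a : seq nat) :=
  all (fun i => all (fun j => (nth 0 a i.+1 < nth 0 a i)
                               ==> (nth 0 a j.+1 <= nth 0 a j))
                    (iota i (size a - i))) (iota 0 (size a)).

Local Open Scope ring_scope.

Lemma size_counts_coef m (vs : seq bitseq) j :
    all (fun v => size v == m) vs ->
  (\sum_(v <- vs) 'X^(count id v) : {poly int})`_j = (nth 0%N (size_counts m vs) j)%:Z.
Proof.
move=> szvs; rewrite coef_sum; under eq_bigr do rewrite coefXn.
transitivity (count (fun v => count id v == j) vs)%:Z.
  rewrite -natr_sum natz -sum1_count [in RHS]big_mkcond /=; congr Posz.
  by apply: eq_bigr => v _; rewrite eq_sym; case: eqP.
have [lt_jm|le_mj] := ltnP j m.+1.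
  by rewrite (nth_map 0%N) ?size_iota // nth_iota.
rewrite nth_default ?size_map ?size_iota //; congr Posz.
apply/eqP; rewrite -leqn0 leqNgt -has_count; apply/hasPn => v /(allP szvs)/eqP sz_v.
by apply: contraTneq le_mj => <-; rewrite -leqNgt -sz_v count_size.
Qed.

Lemma size_bitvecs m : all (fun v => size v == m) (bitvecs m).
Proof.
elim: m => //= m /allP IHm; rewrite all_cat !all_map.
by apply/andP; split; apply/allP => v /IHm /eqP sz_v; rewrite /= sz_v.
Qed.

Lemma humped_models m E : no_valley (size_counts m (models m E)) ->
  humped (\sum_(v <- models m E) 'X^(count id v)).
Proof.
set a := size_counts _ _ => /allP nv.
have coefs j : (\sum_(v <- models m E) 'X^(count id v) : {poly int})`_j = (nth 0%N a j)%:Z.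
  apply: size_counts_coef; apply/allP => v; rewrite mem_filter => /andP[_].
  exact: (allP (size_bitvecs m)).
apply: humped_steps => [i|i j lt_ij]; rewrite !coefs //.
have [lt_j|le_j] := ltnP j (size a); last by rewrite (nth_default _ (leqW le_j)).
have lt_i : (i < size a)%N by apply: ltn_trans lt_j.
have /allP/(_ j) : all
    (fun j => (nth 0 a i.+1 < nth 0 a i) ==> (nth 0 a j.+1 <= nth 0 a j))%N
    (iota i (size a - i)) by apply: nv; rewrite mem_iota.
rewrite mem_iota subnKC ?(ltnW lt_i) // lt_j ltnW // => /(_ isT)/implyP.
by rewrite ltz_nat lez_nat.
Qed.

Local Close Scope ring_scope.

(** * Searching the families that contain many sets *)

(** All ways to add one implication between two points, each named already or
receiving the next free name.  Implications that follow from [E] are skipped,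
as they do not lower the number of models. *)
Definition refinements m (E : implications) : seq (nat * implications) :=
  let vs := models m E in
  [seq (m, p :: E) | p <- [seq (i, j) | i <- iota 0 m, j <- iota 0 m]
                   & has (fun v => nth false v p.1 && ~~ nth false v p.2) vs]
  ++ [seq (m.+1, (i, m) :: E) | i <- iota 0 m]
  ++ [seq (m.+1, (m, i) :: E) | i <- iota 0 m]
  ++ [:: (m.+2, (m, m.+1) :: E)].

Definition dense b c m (E : implications) :=
  b * 2 ^ m <= c * size (models m E).

(** The length of the lists explored stays below the initial [fuel] when [E] is
empty.  Nested conditionals, and not the boolean connectives, keep a
call-by-value evaluation from exploring the branches below a closed one. *)
Fixpoint search (b c : nat) (stop leaf : nat -> implications -> bool) fuel m E :=
  if fuel is fuel'.+1 then
    if ~~ dense b c m E then true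
    else if stop m E then true
    else if leaf m E then
      all (fun mE => search b c stop leaf fuel' mE.1 mE.2) (refinements m E)
    else false
  else false.

Section Topology.
Variables (T : finType) (tau : {set {set T}}).
Hypothesis top_tau : is_topology tau.
Implicit Types (x y : T) (U V : {set T}) (s : seq T) (E : implications).

Definition forces x y := [forall U in tau, (x \in U) ==> (y \in U)].

Lemma forcesP x y :
  reflect (forall U, U \in tau -> x \in U -> y \in U) (forces x y).
Proof.
apply: (iffP forall_inP) => h U tauU; first by move=> xU; apply: implyP (h U tauU) xU.
by apply/implyP/h.
Qed.

Lemma open_bigcap (P : pred {set T}) :
  \bigcap_(V in tau | P V) V \in tau.
Proof.
case: top_tau => _ tauT tauI _.
by apply: (big_ind (fun V => V \in tau)) => // V /andP[].
Qed.

(** Otherwise the least open set around each point of [U] would lie in [U], which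
would be the union of these sets. *)
Lemma open_separation U : U \notin tau ->
  exists x y, [/\ x \in U, y \notin U & forces x y].
Proof.
move=> tau'U; case: (boolP [exists x in U, exists y in ~: U, forces x y]).
  by case/exists_inP=> x xU /exists_inP[y]; rewrite inE; exists x, y.
rewrite negb_exists_in => /forall_inP noxy; case/negP: tau'U.
pose hull x := \bigcap_(V in tau | x \in V) V.
rewrite (_ : U = cover [set hull x | x in U]).
  case: top_tau => _ _ _; apply; apply/subsetP=> _ /imsetP[x _ ->].
  exact: open_bigcap.
apply/setP=> z; apply/idP/bigcupP=> [zU | [_ /imsetP[x xU ->] zx]].
  by exists (hull z); [apply: imset_f | apply/bigcapP=> V /andP[]].
have := noxy x xU; rewrite negb_exists_in => /forall_inP/(_ z).
rewrite inE => noxz; apply: contraT => /noxz/negP; case.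
by apply/forcesP => V tauV xV; apply: (bigcapP zx); rewrite tauV.
Qed.

Definition satisfies s E := forall U, U \in tau -> obeys E (profile s U).

Definition presented s E := forall U, (U \in tau) = obeys E (profile s U).

Lemma card_satisfies s E : uniq s -> satisfies s E ->
  #|tau| <= 2 ^ (#|T| - size s) * size (models (size s) E).
Proof.
move=> uniq_s satE; rewrite -card_obeys //; apply/subset_leq_card/subsetP => U.
by rewrite inE; apply: satE.
Qed.

(** Both sides of [card_satisfies] scale by 2 for each unnamed point. *)
Lemma dense_satisfies b c s E : b * 2 ^ #|T| <= c * #|tau| ->
  uniq s -> satisfies s E -> dense b c (size s) E.
Proof.
move=> big_tau uniq_s satE; rewrite /dense.
have := leq_trans big_tau (leq_mul (leqnn c) (card_satisfies uniq_s satE)).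
rewrite -{1}(subnK (size_uniq_card uniq_s)) expnD mulnCA [leqRHS]mulnCA.
by rewrite leq_pmul2l ?expn_gt0.
Qed.

(** [t] lists those of the points [x] and [y] that have no name in [s]. *)
Lemma satisfies_cons s t E x y : scoped (size s) E -> satisfies s E ->
    forces x y -> x \in s ++ t -> y \in s ++ t ->
  satisfies (s ++ t) ((index x (s ++ t), index y (s ++ t)) :: E) /\
  scoped (size (s ++ t)) ((index x (s ++ t), index y (s ++ t)) :: E).
Proof.
move=> ovE satE /forcesP xy xs ys; split=> [U tauU|]; last first.
  by rewrite /= !index_mem xs ys (scoped_widen _ ovE) // size_cat leq_addr.
rewrite /= !nth_profile_index // (scoped_cat _ _ ovE) satE // andbT.
exact/implyP/xy.
Qed.

(** As long as the current list does not present [tau], some set obeys it without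
being open, and [open_separation] yields an implication that holds in [tau] but
fails for that set: one of the refinements. *)
Lemma search_sound b c stop leaf fuel s E :
    b * 2 ^ #|T| <= c * #|tau| ->
    uniq s -> scoped (size s) E -> satisfies s E ->
    search b c stop leaf fuel (size s) E ->
  exists s' E', [/\ uniq s', scoped (size s') E', satisfies s' E'
    & stop (size s') E' \/ presented s' E' /\ leaf (size s') E'].
Proof.
move=> big_tau; elim: fuel s E => //= fuel IH s E uniq_s ovE satE.
rewrite (dense_satisfies big_tau) //=.
case: ifP => [stopE _|_]; first by exists s, E; split=> //; left.
case: ifP => // leafE /allP search_next.
case: (boolP [forall U, (U \in tau) == obeys E (profile s U)]) => [/forallP pE|].
  by exists s, E; split=> //; right; split=> // U; apply/eqP.
rewrite negb_forall => /existsP[U neqU].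
have [tau'U obeyU] : U \notin tau /\ obeys E (profile s U).
  move: neqU; case: (boolP (U \in tau)) => [/satE->//|_].
  by rewrite eq_sym eqbF_neg negbK.
have [x [y [xU yU xy]]] := open_separation tau'U.
have neq_xy : x != y by apply: contraNneq yU => <-.
have step t : uniq (s ++ t) -> x \in s ++ t -> y \in s ++ t ->
    (size (s ++ t), (index x (s ++ t), index y (s ++ t)) :: E)
      \in refinements (size s) E ->
    exists s' E', [/\ uniq s', scoped (size s') E', satisfies s' E'
      & stop (size s') E' \/ presented s' E' /\ leaf (size s') E'].
  move=> uniq_st xst yst /search_next/= srch.
  have [sat' ov'] := satisfies_cons ovE satE xy xst yst.
  exact: IH srch.
have [xs|xs] := boolP (x \in s); have [ys|ys] := boolP (y \in s).
- apply: (step [::]); rewrite cats0 // mem_cat; apply/orP; left.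
  apply: map_f; rewrite mem_filter allpairs_f ?mem_iota ?index_mem // andbT.
  apply/hasP; exists (profile s U); first by rewrite mem_filter obeyU profile_bitvecs.
  by rewrite /= !nth_profile_index // xU.
- apply: (step [:: y]); rewrite ?cats1 ?rcons_uniq ?ys ?mem_rcons ?inE ?xs ?eqxx ?orbT //.
  rewrite -cats1 !index_cat xs (negPf ys) /= eqxx addn0 size_cat addn1 !mem_cat.
  apply/orP; right; apply/orP; left; apply/mapP.
  by exists (index x s); rewrite // mem_iota index_mem.
- apply: (step [:: x]); rewrite ?cats1 ?rcons_uniq ?xs ?mem_rcons ?inE ?ys ?eqxx ?orbT //.
  rewrite -cats1 !index_cat ys (negPf xs) /= eqxx addn0 size_cat addn1 !mem_cat.
  apply/orP; right; apply/orP; right; apply/orP; left; apply/mapP.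
  by exists (index y s); rewrite // mem_iota index_mem.
apply: (step [:: x; y]).
- by rewrite cat_uniq uniq_s /= inE neq_xy orbF negb_or xs ys.
- by rewrite mem_cat mem_head orbT.
- by rewrite mem_cat !inE eqxx !orbT.
rewrite !index_cat (negPf xs) (negPf ys) /= eqxx (negPf neq_xy) eqxx.
by rewrite addn0 addn1 size_cat addn2 !mem_cat mem_head !orbT.
Qed.

End Topology.

(** * The open set polynomial and complementation *)

Local Open Scope ring_scope.

Section OpenSetPoly.
Variables (T : finType) (tau : {set {set T}}).

Lemma coef_open_set_poly j : (open_set_poly tau)`_j = (num_open tau j)%:Z.
Proof.
rewrite /open_set_poly -(poly_def _ (fun j => (num_open tau j)%:Z)) coef_poly.
case: ltnP => // lt_nj; apply/esym/eqP; rewrite eqz_nat cards_eq0.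
apply/eqP/setP => A; rewrite !inE; apply/andP => -[_ /eqP cardA].
by have := max_card (mem A); rewrite cardA leqNgt lt_nj.
Qed.

Lemma open_set_polyE : open_set_poly tau = \sum_(U in tau) 'X^#|U|.
Proof.
apply/polyP => j; rewrite coef_open_set_poly coef_sum.
under eq_bigr do rewrite coefXn.
rewrite -natr_sum natz; congr Posz; rewrite /num_open -sum1dep_card big_mkcondr /=.
by apply: eq_bigr => U _; rewrite eq_sym; case: eqP.
Qed.

End OpenSetPoly.

Section Complement.
Variables (T : finType) (tau : {set {set T}}).
Hypothesis top_tau : is_topology tau.

Definition closed_sets := [set U : {set T} | ~: U \in tau].

Lemma closed_sets_topology : is_topology closed_sets.
Proof.
case: top_tau => tau0 tauT tauI tauU; split; rewrite ?inE ?setC0 ?setCT //.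
  move=> A B; rewrite !inE setCI => tauA tauB.
  have := tauU [set ~: A; ~: B]; rewrite /cover bigcup_setU !big_set1; apply.
  by rewrite subUset !sub1set tauA.
move=> F /subsetP closedF; rewrite inE /cover setC_bigcup.
apply: (big_ind (fun V => V \in tau)) => // A /closedF.
by rewrite inE.
Qed.

Lemma card_closed_sets : #|closed_sets| = #|tau|.
Proof.
rewrite -(card_imset tau (can_inj (@setCK T))); apply: eq_card => U.
rewrite inE; apply/idP/imsetP => [tauU|[V tauV ->]]; last by rewrite setCK.
by exists (~: U); rewrite ?setCK.
Qed.

Lemma closed_sets_forces x y : forces closed_sets x y = forces tau y x.
Proof.
apply/forcesP/forcesP=> h U; rewrite ?inE => tauU.
  by apply: contraTT => xU; have := h (~: U); rewrite !inE setCK; apply.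
have := h _ tauU; rewrite !inE => /contraTT; apply.
Qed.

Lemma num_open_closed_sets j : (j <= #|T|)%N ->
  num_open closed_sets j = num_open tau (#|T| - j).
Proof.
move=> le_jn; rewrite /num_open -(card_imset _ (can_inj (@setCK T))).
apply: eq_card => U; rewrite inE; apply/imsetP/andP => [[V]|[tauU /eqP cardU]].
  by rewrite !inE => /andP[tauV /eqP <-] ->; rewrite tauV -(cardsC V) addKn.
exists (~: U); rewrite ?setCK // !inE setCK tauU /=.
by apply/eqP; have := cardsC U; rewrite cardU; lia.
Qed.

(** Taking complements reverses the sequence of coefficients. *)
Lemma humped_closed_sets :
  humped (open_set_poly closed_sets) -> humped (open_set_poly tau).
Proof.
move=> hump; apply: (humped_rev (n := #|T|) hump) => j.
rewrite !coef_open_set_poly; case: leqP => [le_jn|lt_nj].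
  by rewrite num_open_closed_sets ?leq_subr // subKn.
apply/eqP; rewrite eqz_nat cards_eq0.
apply/eqP/setP => A; rewrite !inE; apply/andP => -[_ /eqP cardA].
by have := max_card (mem A); rewrite cardA leqNgt lt_nj.
Qed.

End Complement.

(** * A point lying below at least four others *)

Local Close Scope ring_scope.

(** Two independent implications leave at most 5/8 of the subsets. *)
Lemma search_few_implications :
  search 11 16 (fun _ _ => false) (fun _ E => size E <= 1) 3 0 [::].
Proof. by vm_compute. Qed.

Local Open Scope ring_scope.

Section Star.
Variables (T : finType) (tau : {set {set T}}) (a : T).
Hypothesis top_tau : is_topology tau.

Let S := [set y | forces tau a y & y != a].
Let k := #|S|.
Let n := #|T|.

Hypothesis k_ge4 : (4 <= k)%N.
Hypothesis big_tau : (3 * 2 ^ n <= 8 * #|tau|)%N.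

Let aS : a \notin S. Proof. by rewrite inE eqxx andbF. Qed.

Let card_aS : #|a |: S| = k.+1. Proof. by rewrite cardsU1 aS. Qed.

Let le_kn : (k < n)%N. Proof. by rewrite -card_aS max_card. Qed.

Let S_open U : U \in tau -> a \in U -> S \subset U.
Proof.
move=> tauU aU; apply/subsetP => y; rewrite inE => /andP[/forcesP ay _].
exact: ay aU.
Qed.

Lemma star_open : a |: S \in tau.
Proof.
apply: contraT => /(open_separation top_tau)[x [y [xS yS /forcesP xy]]].
have [tau0 tauT tauI tauU] := top_tau.
case/negP: yS; rewrite !inE; have [//|_ /=] := eqVneq y a; rewrite andbT.
apply/forcesP => U tauU' aU; apply: xy => //.
by case/setU1P: xS => [->//|]; apply/subsetP/S_open.
Qed.

(** An open set containing [a] contains [S] as well. *)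
Lemma card_open_with :
  (#|[set U in tau | a \in U]| <= 2 ^ (n - k.+1))%N.
Proof.
have -> : (n - k.+1 = #|[set: T] :\: (a |: S)|)%N.
  by rewrite cardsDS ?subsetT // cardsT card_aS.
rewrite -card_interval ?subsetT //.
apply/subset_leq_card/subsetP => U; rewrite !inE subsetT andbT => /andP[tauU aU].
by rewrite subUset sub1set aU S_open.
Qed.

(** 3/8 - 1/32 = 11/32, as [k >= 4]. *)
Lemma card_open_without :
  (11 * 2 ^ n <= 32 * #|[set U in tau | a \notin U]|)%N.
Proof.
have := cardsID [set U : {set T} | a \in U] tau.
have -> : tau :&: [set U : {set T} | a \in U] = [set U in tau | a \in U].
  by apply/setP => U; rewrite !inE.
have -> : tau :\: [set U : {set T} | a \in U] = [set U in tau | a \notin U].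
  by apply/setP => U; rewrite !inE andbC.
have : (32 * #|[set U in tau | a \in U]| <= 2 ^ n)%N.
  apply: leq_trans (leq_mul (leqnn 32) card_open_with) _.
  by rewrite (_ : 32 = 2 ^ 5)%N // -expnD leq_exp2l //; lia.
move: big_tau; move: (2 ^ n)%N => N; set u := #|tau|; set v := #|_|; set w := #|_|; lia.
Qed.

(** A point [x] below [a] would be missing, like [a], from all the sets counted in
[card_open_without], which would then be at most 1/4 of all subsets. *)
Lemma open_setC1 : [set~ a] \in tau.
Proof.
apply: contraT => /(open_separation top_tau)[x [y [xa]]].
rewrite !inE negbK => /eqP-> /forcesP {y} xa'.
have neq_xa : x != a by rewrite -in_setC1.
suff: (#|[set U in tau | a \notin U]| <= 2 ^ (n - 2))%N.
  move=> le_card; have := card_open_without.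
  have := leq_mul (leqnn 32) le_card.
  rewrite {2}(_ : n = (n - 2) + 2)%N; last by lia.
  have := expn_gt0 2 (n - 2); rewrite expnD; lia.
have -> : (n - 2 = #|~: [set a; x] :\: set0|)%N.
  by rewrite setD0 cardsCs setCK cards2 eq_sym neq_xa.
rewrite -card_interval ?sub0set //.
apply/subset_leq_card/subsetP => U; rewrite !inE sub0set => /andP[tauU aU].
rewrite subsetC; apply/subsetP => z; rewrite !inE => /orP[]/eqP-> //.
by apply: contra aU; apply: xa'.
Qed.

(** The topology induced on the complement of [a], with [a] added back as a point
subject to no implication.  Staying on the type [T] makes the search applicable
to it without transport to a subtype. *)
Definition prune := [set U : {set T} | U :\ a \in tau].

Lemma prune_topology : is_topology prune.
Proof.
have [tau0 tauT tauI tauU] := top_tau; split.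
- by rewrite inE set0D.
- by rewrite inE setTD open_setC1.
- by move=> A B; rewrite !inE setDIl; apply: tauI.
move=> F /subsetP pruneF; rewrite inE.
rewrite (_ : _ :\ a = cover [set U :\ a | U in F]).
  by apply: tauU; apply/subsetP => _ /imsetP[U FU ->]; have := pruneF U FU; rewrite inE.
apply/setP => z; apply/setD1P/bigcupP => [[za /bigcupP[U FU zU]]|].
  by exists (U :\ a); [apply/imsetP; exists U | apply/setD1P].
case=> _ /imsetP[U FU ->] /setD1P[za zU]; split=> //.
by apply/bigcupP; exists U.
Qed.

(** The implications of [tau] are those of [prune] and the ones from [a] to [S]. *)
Lemma open_star U :
  (U \in tau) = (U \in prune) && ((a \in U) ==> (S \subset U)).
Proof.
have [tau0 tauT tauI tauU] := top_tau; rewrite inE.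
apply/idP/andP => [tauU'|[pruneU aSU]].
  split; last by apply/implyP; apply: S_open.
  by rewrite setDE setIC tauI // open_setC1.
have [aU|aU] := boolP (a \in U); last first.
  by move: pruneU; rewrite (setDidPl _) // disjoint_sym disjoints1.
rewrite aU /= in aSU.
suff -> : U = cover [set U :\ a; a |: S].
  by apply: tauU; rewrite subUset !sub1set pruneU star_open.
rewrite /cover bigcup_setU !big_set1 setUA [_ :|: [set a]]setUC setD1K //.
exact/esym/setUidPl.
Qed.

Lemma card_prune : (11 * 2 ^ n <= 16 * #|prune|)%N.
Proof.
apply: leq_trans (card_open_without) _.
rewrite -(cardsID [set U : {set T} | a \in U] prune).
have -> : prune :\: [set U : {set T} | a \in U] = [set U in tau | a \notin U].
  apply/setP => U; rewrite !inE; have [//|aU] := boolP (a \in U); rewrite ?andbF //.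
  by rewrite (setDidPl _) ?andbT // disjoint_sym disjoints1.
suff : (#|[set U in tau | a \notin U]| <=
        #|prune :&: [set U : {set T} | a \in U]|)%N.
  set u := #|_|; set v := #|_|; lia.
rewrite -(card_in_imset (f := fun U => a |: U) (D := [set U in tau | a \notin U])).
  apply/subset_leq_card/subsetP => _ /imsetP[U + ->].
  by rewrite !inE eqxx andbT => /andP[tauU aU]; rewrite setU1K.
move=> U V; rewrite !inE => /andP[_ aU] /andP[_ aV] /(congr1 (fun W => W :\ a)).
by rewrite !setU1K.
Qed.

Lemma prune_setU1 U : (a |: U \in prune) = (U \in prune).
Proof. by rewrite !inE setDUl setDv set0U. Qed.

(** Taking [c = d] accounts for a discrete [prune]. *)
Lemma prune_single : exists c d,
  forall U, (U \in prune) = ((c \in U) ==> (d \in U)).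
Proof.
have [//|//|//|s [E] ] := search_sound (s := [::]) (E := [::]) prune_topology card_prune
  _ _ _ search_few_implications.
case=> uniq_s ovE satE [//|[presE]].
case: E presE ovE satE => [|[i j] []] //= presE.
  by exists a, a => U; rewrite presE implybb.
rewrite andbT => /andP[lt_is lt_js] _ _; exists (nth a s i), (nth a s j) => U.
by rewrite presE /= andbT !(nth_profile a).
Qed.

(** The sets without [a] form one interval, for which the condition on [S] is void;
those with [a] form another one, empty unless [S] is contained in [B]. *)
Lemma sum_star_between (R : comNzRingType) (x : R) (A B : {set T}) :
    A \subset B -> a \notin A -> a \in B ->
  \sum_(U : {set T} | ((a \in U) ==> (S \subset U)) && ((A \subset U) && (U \subset B)))
     x ^+ #|U| =
  x ^+ #|A| * (1 + x) ^+ #|B :\: A|.-1 +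
  (if S \subset B then x ^+ #|A :|: (a |: S)| * (1 + x) ^+ #|B :\: (A :|: (a |: S))|
   else 0).
Proof.
move=> sAB aA aB; rewrite (bigID (fun U : {set T} => a \in U)) [LHS]addrC /=; congr (_ + _).
  have -> : #|B :\: A|.-1 = #|(B :\ a) :\: A|.
    by rewrite (cardsD1 a (B :\: A)) !inE aA aB setDDl setDDl setUC.
  rewrite -sum_interval; last by rewrite subsetD1 sAB.
  apply: eq_bigl => U; rewrite subsetD1; case: (a \in U) => /=; rewrite ?andbF //.
  by rewrite !andbT.
case: ifPn => [sSB|nSB].
  rewrite -sum_interval; last by rewrite !subUset sub1set sAB aB.
  apply: eq_bigl => U; rewrite !subUset sub1set.
  by case: (a \in U); rewrite /= ?andbF // !andbT; case: (S \subset U); rewrite ?andbF ?andbT.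
apply: big_pred0 => U; apply: contraNF nSB.
by case: (a \in U); rewrite /= ?andbF ?andbT // => /andP[sSU /andP[_ /(subset_trans sSU)]].
Qed.

Lemma sum_star (R : comNzRingType) (x : R) :
  \sum_(U : {set T} | (a \in U) ==> (S \subset U)) x ^+ #|U| =
  (1 + x) ^+ (n - k.+1) * ((1 + x) ^+ k + x ^+ k.+1).
Proof.
transitivity (\sum_(U : {set T} | ((a \in U) ==> (S \subset U)) &&
    ((set0 \subset U) && (U \subset [set: T]))) x ^+ #|U|).
  by apply: eq_bigl => U; rewrite sub0set subsetT !andbT.
rewrite sum_star_between ?inE ?subsetT // setD0 set0U cardsDS ?subsetT //.
rewrite cardsT cards0 card_aS (_ : #|T|.-1 = (n - k.+1) + k)%N; last by lia.
rewrite expr0 mul1r exprD -/n; move: (_ ^+ (n - _)) (_ ^+ k) (_ ^+ k.+1) => u v w.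
by ring.
Qed.

(** The sets violating c -> d are those between [[set c]] and [~: [set d]]; their
contribution, again given by [sum_star_between], is subtracted from [sum_star].
It has no part with [a] when [d] lies in [S]. *)
Lemma sum_star_implication (R : comNzRingType) (x : R) (c d : T) :
    c != a -> d != a -> c != d -> (c \in S -> d \in S) ->
  \sum_(U : {set T} | ((c \in U) ==> (d \in U)) && ((a \in U) ==> (S \subset U)))
     x ^+ #|U| =
  if d \in S then
    (1 + x) ^+ (n - k.+1) * ((1 + x) ^+ (k - 2) * (1 + x + x ^+ 2) + x ^+ k.+1)
  else (1 + x) ^+ (n - k.+3) * ((1 + x + x ^+ 2) * ((1 + x) ^+ k + x ^+ k.+1)).
Proof.

move=> ca da cd cdS; pose P (U : {set T}) := (a \in U) ==> (S \subset U).
have -> : \sum_(U : {set T} | ((c \in U) ==> (d \in U)) && P U) x ^+ #|U| =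
    \sum_(U : {set T} | P U) x ^+ #|U| -
    \sum_(U : {set T} | P U && (([set c] \subset U) && (U \subset ~: [set d]))) x ^+ #|U|.
  rewrite [in RHS](bigID (fun U : {set T} => (c \in U) ==> (d \in U))) /=.
  rewrite -addrA [X in _ + X](_ : _ = 0) ?addr0.
    by apply: eq_bigl => U; rewrite andbC.
  apply/eqP; rewrite subr_eq0; apply/eqP; apply: eq_bigl => U.
  by rewrite negb_imply sub1set subsetC sub1set inE.
rewrite sum_star sum_star_between; first last.
- by rewrite !inE eq_sym.
- by rewrite !inE eq_sym.
- by rewrite sub1set !inE.
have -> : #|~: [set d] :\: [set c]|.-1 = (n - 3)%N.
  rewrite cardsDS ?sub1set ?inE // cards1; have := cardsC [set d]; rewrite cards1.
  rewrite -/n; set u := #|_|; lia.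
rewrite cards1 expr1 subsetC sub1set in_setC.
have [dS|dS] := boolP (d \in S) => /=.
  rewrite addr0 (_ : n - 3 = (n - k.+1) + (k - 2))%N; last by lia.
  have defk : k = (k - 2).+2 by lia.
  rewrite [in (1 + x) ^+ k]defk exprD !exprS.
  move: (_ ^+ (n - _)) (_ ^+ (k - 2)) (x ^+ k) => u v w.
  by ring.
have cS : c \notin S by apply: contra dS.
have cardU : #|c |: (a |: S)| = k.+2.
  by rewrite cardsU1 card_aS in_setU1 negb_or ca cS.
have lt_kn2 : (k.+2 < n)%N.
  have := max_card (mem (d |: (c |: (a |: S)))).
  by rewrite cardsU1 cardU !in_setU1 !negb_or da dS eq_sym cd.
have -> : #|~: [set d] :\: (c |: (a |: S))| = (n - k.+3)%N.
  rewrite setDE -setCU cardsCs setCK cardsU1 cardU !in_setU1 !negb_or.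
  by rewrite da dS eq_sym cd.
rewrite cardU (_ : n - 3 = (n - k.+3) + k)%N; last by lia.
rewrite (_ : n - k.+1 = (n - k.+3).+2)%N; last by lia.
rewrite exprD !exprS.
move: (_ ^+ (n - _)) (_ ^+ k) (x ^+ k) => u v w.
by ring.
Qed.

End Star.

Lemma size_binomialX k : size ((1 + 'X) ^+ k : {poly int}) = k.+1.
Proof.
have sz : size (1 + 'X : {poly int}) = 2 by rewrite addrC size_XaddC.
have nz : (1 + 'X : {poly int}) ^+ k != 0.
  by rewrite expf_neq0 // -size_poly_gt0 sz.
by rewrite -(prednK (n := size _)) ?size_poly_gt0 // size_exp sz mul1n.
Qed.

Lemma monic_binomialX k : (1 + 'X) ^+ k \is @monic int.
Proof. by rewrite monic_exp // addrC monicXaddC. Qed.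

Lemma size_trinomial : size (1 + 'X + 'X^2 : {poly int}) = 3.
Proof. by rewrite addrC size_polyDl size_polyXn // addrC size_XaddC. Qed.

Lemma monic_trinomial : 1 + 'X + 'X^2 \is @monic int.
Proof.
by rewrite monicE addrC lead_coefDl ?lead_coefXn // size_polyXn addrC size_XaddC.
Qed.

Lemma humped_star_poly k : humped ((1 + 'X) ^+ k + 'X^(k.+1)).
Proof.
rewrite -(size_binomialX k); apply: humped_addXsize (monic_binomialX k) _.
by have := humped_binomialX k humped_1; rewrite mulr1.
Qed.

Lemma humped_star_edge_poly k : (1 < k)%N ->
  humped ((1 + 'X) ^+ (k - 2) * (1 + 'X + 'X^2) + 'X^(k.+1)).
Proof.
move=> k_gt1; set p := _ * _.
have -> : k.+1 = size p.
  rewrite size_monicM ?monic_binomialX ?monic_neq0 ?monic_trinomial //.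
  by rewrite size_binomialX size_trinomial; lia.
apply: humped_addXsize; first by rewrite monicMl ?monic_binomialX ?monic_trinomial.
apply: humped_binomialX.
by have := humped_trinomial humped_1; rewrite mulr1.
Qed.

(** By [prune_single] the topology is a star at [a], possibly with one further
implication c -> d; both sums have been computed in closed form. *)
Lemma humped_star (T : finType) (tau : {set {set T}}) (a : T) :
    is_topology tau -> (3 * 2 ^ #|T| <= 8 * #|tau|)%N ->
    (4 <= #|[set y | forces tau a y & y != a]|)%N ->
  humped (open_set_poly tau).
Proof.
move=> top_tau big_tau k_ge4; rewrite open_set_polyE.
have [c [d defprune]] := prune_single top_tau k_ge4 big_tau.
set S := [set y | forces tau a y & y != a] in k_ge4.
have sum_tau (P : pred {set T}) :
    (forall U, (U \in tau) = P U) ->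
    \sum_(U in tau) 'X^#|U| = \sum_(U | P U) 'X^#|U| :> {poly int}.
  by move=> defP; apply: eq_bigl.
have in_tau := open_star top_tau k_ge4 big_tau.
have [eq_cd|neq_cd] := eqVneq c d.
  rewrite (sum_tau (fun U => (a \in U) ==> (S \subset U))) => [|U]; last first.
    by rewrite in_tau defprune eq_cd implybb.
  by rewrite sum_star //; apply: humped_binomialX; apply: humped_star_poly.
have ca : c != a.
  apply/negP => /eqP eq_ca; have := prune_setU1 tau a set0.
  by rewrite !defprune setU0 !inE eq_ca eqxx -eq_ca eq_sym (negPf neq_cd).
have da : d != a.
  apply/negP => /eqP eq_da; have := prune_setU1 tau a [set c].
  by rewrite !defprune !inE eqxx orbT eq_da eqxx eq_sym (negPf ca).
have cdS : c \in S -> d \in S.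
  move=> cS; have := star_open a top_tau; rewrite in_tau defprune -/S => /andP[+ _].
  by rewrite !in_setU1 cS orbT (negPf da).
rewrite (sum_tau (fun U =>
  ((c \in U) ==> (d \in U)) && ((a \in U) ==> (S \subset U)))); last first.
  by move=> U; rewrite in_tau defprune.
rewrite sum_star_implication //; case: ifP => _; apply: humped_binomialX.
  by apply: humped_star_edge_poly; apply: leq_trans k_ge4.
exact: humped_trinomial (humped_star_poly _).
Qed.

(** * Topologies with at least 3/8 of all subsets open *)

Local Close Scope ring_scope.

Definition upper_degree (E : implications) i :=
  size (undup [seq p.2 | p <- E & (p.1 == i) && (p.2 != i)]).
Definition lower_degree (E : implications) i :=
  size (undup [seq p.1 | p <- E & (p.2 == i) && (p.1 != i)]).

Definition wide m E :=
  has (fun i => (4 <= upper_degree E i) || (4 <= lower_degree E i)) (iota 0 m).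

(** The list is read with at least five named points because fewer are not enough:
with a and b both below c and d, four points give the counts 1, 2, 1, 2, 1. *)
Definition humped_leaf m E :=
  let M := maxn m 5 in no_valley (size_counts M (models M E)).

Lemma search_large : search 3 8 wide humped_leaf 7 0 [::].
Proof. by vm_compute. Qed.

Local Open Scope ring_scope.

(** Unused points are named until there are at least five names; the remaining
ones contribute factors [1 + 'X]. *)
Lemma humped_presented (T : finType) (tau : {set {set T}}) (s : seq T) E :
    (5 <= #|T|)%N -> uniq s -> scoped (size s) E -> presented tau s E ->
  humped_leaf (size s) E -> humped (open_set_poly tau).
Proof.
move=> n_ge5 uniq_s scE presE leafE.
pose t := take (5 - size s) [seq x <- enum T | x \notin s].
have uniq_st : uniq (s ++ t).
  rewrite cat_uniq uniq_s (take_uniq _ (filter_uniq _ (enum_uniq T))) andbT.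
  by apply/hasPn => x /mem_take; rewrite mem_filter => /andP[].
have size_st : size (s ++ t) = maxn (size s) 5.
  rewrite size_cat size_takel; first by rewrite maxnE.
  rewrite size_filter -(leq_add2l (count [in s] (enum T))) count_predC.
  rewrite -cardE -size_filter; have -> : size [seq x <- enum T | x \in s] = size s.
    apply/perm_size/uniq_perm => [|//|x]; first exact/filter_uniq/enum_uniq.
    by rewrite mem_filter mem_enum andbT.
  by move: (size_uniq_card uniq_s) n_ge5; move: #|T| => N; lia.
rewrite open_set_polyE (eq_bigl (fun U => obeys E (profile (s ++ t) U))) => [|U]; last first.
  by rewrite presE scoped_cat.
rewrite sum_obeys //; apply/humped_binomialX/humped_models.
by rewrite size_st.
Qed.

Lemma wide_star (T : finType) (tau : {set {set T}}) (s : seq T) E :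
    uniq s -> scoped (size s) E -> satisfies tau s E -> wide (size s) E ->
  exists a, (4 <= #|[set y | forces tau a y & y != a]|)%N \/
            (4 <= #|[set y | forces tau y a & y != a]|)%N.
Proof.
move=> uniq_s /allP scE satE /hasP[i]; rewrite mem_iota => /andP[_ lt_is] degE.
have [a _] : exists a : T, true by case: (s) lt_is => // a; exists a.
have forcesE p : p \in E -> forces tau (nth a s p.1) (nth a s p.2).
  move=> pE; apply/forcesP => U /satE /allP/(_ p pE).
  by have /andP[lt1 lt2] := scE p pE; rewrite !(nth_profile a) // => /implyP.
have inj_nth (r : seq nat) (A : {set T}) :
    uniq r -> {subset r <= [pred j | (j < size s)%N]} ->
    (forall j, j \in r -> nth a s j \in A) -> (size r <= #|A|)%N.
  move=> uniq_r ltr rA; rewrite -(size_map (nth a s)) cardE; apply: uniq_leq_size.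
    by rewrite map_inj_in_uniq // => j l /ltr lt_j /ltr lt_l /eqP; rewrite nth_uniq // => /eqP.
  by move=> _ /mapP[j /rA + ->]; rewrite mem_enum.
exists (nth a s i); case/orP: degE => /leq_trans le_deg; [left|right];
  apply/le_deg/inj_nth; rewrite ?undup_uniq // => j;
  rewrite mem_undup => /mapP[p]; rewrite mem_filter => /andP[/andP[/eqP <- neq] pE] ->;
  have /andP[lt1 lt2] := scE p pE; rewrite ?inE //.
  by rewrite forcesE // nth_uniq.
by rewrite forcesE // nth_uniq.
Qed.

Local Close Scope ring_scope.

Theorem theorem3p19 (n : nat) (T : finType) (tau : {set {set T}})
    (n_ge5 : 5 <= n) (card_T : #|T| = n) (top_tau : is_topology tau)
    (card_tau : 6 * 2 ^ (n - 4) <= #|tau|) :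
  unimodal_poly (open_set_poly tau).
Proof.
apply: unimodal_humped; rewrite -{n}card_T in n_ge5 card_tau.
have big_tau : 3 * 2 ^ #|T| <= 8 * #|tau|.
  apply: leq_trans (leq_mul (leqnn 8) card_tau).
  by rewrite -{1}(subnK (ltnW n_ge5)) expnD; lia.
have [//|//|//|s [E []]] := search_sound (s := [::]) (E := [::]) top_tau big_tau
  _ _ _ search_large.
move=> uniq_s scE satE [wideE|[presE leafE]]; last first.
  exact: humped_presented leafE.
have [a [le_up|le_down]] := wide_star uniq_s scE satE wideE.
  exact: humped_star le_up.
apply: humped_closed_sets; apply: (@humped_star _ _ a).
- exact: closed_sets_topology.
- by rewrite card_closed_sets.
rewrite (_ : [set y | _ & _] = [set y | forces tau y a & y != a]) //.
by apply/setP => y; rewrite !inE closed_sets_forces.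
Qed.
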